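(* Let $n\ge 1$ and let $A=[a_{i,j}]\in\mathcal{H}_n$ be such that $$\operatorname{per}(A\circ B)\le \operatorname{per}(A)\prod_{i=1}^n b_{i,i}\qquad\text{for all } B=[b_{i,j}]\in\mathcal{H}_n .$$ Then $$\lambda_{\max}(F_A)\le \operatorname{per}(A).$$
   Context: $\mathcal{H}_n$ denotes the set of $n\times n$ positive semidefinite Hermitian (complex) matrices. The permanent of an $n\times n$ matrix $A=[a_{i,j}]$ is $\operatorname{per}(A)=\sum_{\sigma\in S_n}\prod_{i=1}^n a_{i,\sigma(i)}$ (it is a nonnegative real number when $A\in\mathcal{H}_n$). $A\circ B=[a_{i,j}b_{i,j}]$ is the Hadamard (entrywise) product. For $A\in\mathcal{H}_n$, $F_A=[f_{i,j}]$ is the $n\times n$ matrix with $f_{i,j}=a_{i,j}\operatorname{per}(A(i,j))$, where $A(i,j)$ is the $(n-1)\times(n-1)$ submatrix of $A$ obtained by deleting the $i$-th row and $j$-th column (the permanent of an empty matrix is $1$); $F_A$ is again a positive semidefinite Hermitian matrix, and $\lambda_{\max}(F_A)$ denotes its largest eigenvalue. *)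

(* Defs.v *)
From HB Require Import structures.
From mathcomp Require Import all_boot all_order all_algebra all_fingroup.
From mathcomp Require Import sesquilinear spectral.
From mathcomp Require Import complex.
From mathcomp Require Import boolp classical_sets reals.

Set Implicit Arguments.
Unset Strict Implicit.
Unset Printing Implicit Defensive.

Import Order.TTheory GRing.Theory Num.Theory.
Local Open Scope ring_scope.
Local Open Scope complex_scope.
Local Open Scope sesquilinear_scope.

Definition permanent (C : comNzRingType) (n : nat) (A : 'M[C]_n) : C :=
  \sum_(s : 'S_n) \prod_(i < n) A i (s i).

Definition hadamard (C : comNzRingType) (n : nat) (A B : 'M[C]_n) : 'M[C]_n :=
  \matrix_(i, j) (A i j * B i j).

(* The order on a [numClosedFieldType] is partial: [0 <= z] says that [z] is
   real and nonnegative. *)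
Definition psd_hermitian (C : numClosedFieldType) (n : nat) (A : 'M[C]_n) :
    Prop :=
  A \is hermsymmx /\ forall v : 'cV[C]_n, 0 <= (v ^t* *m A *m v) 0 0.

Definition F_mx (C : comNzRingType) (n : nat) (A : 'M[C]_n) : 'M[C]_n :=
  \matrix_(i, j) (A i j * permanent (row' i (col' j A))).

(* The supremum of the real eigenvalues, hence a junk value when there are
   none. For a nonempty Hermitian matrix it is the largest eigenvalue, see
   [lambda_maxP]. *)
Definition lambda_max (R : realType) (n : nat) (M : 'M[R[i]]_n) : R :=
  sup [set x : R | eigenvalue M x%:C]%classic.

Lemma hermitian_eigenvalue_real (C : numClosedFieldType) (n : nat)
    (M : 'M[C]_n) (a : C) :
  M \is hermsymmx -> eigenvalue M a -> a \is Num.real.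
Proof.
move=> /is_hermitianmxP; rewrite expr0 scale1r => Mh /eigenvalueP[v vM v0].
have vMt : M *m v ^t* = a^* *: v ^t*.
  by rewrite {1}Mh -map_mxM -trmx_mul vM linearZ /= map_mxZ.
have : v *m M *m v ^t* = v *m (M *m v ^t*) by rewrite mulmxA.
rewrite vM vMt -scalemxAl -scalemxAr => /matrixP/(_ 0 0).
rewrite !mxE => /mulIf aa.
apply/CrealP/esym/aa; apply: contra v0 => /eqP.
under eq_bigr do rewrite !mxE.
have vv_ge0 i : true -> 0 <= v 0 i * (v 0 i)^* by rewrite mul_conjC_ge0.
move=> /(psumr_eq0P (fun i _ => vv_ge0 i isT)) vv0.
apply/eqP/rowP => i; rewrite mxE; apply/eqP.
by rewrite -mul_conjC_eq0 vv0.
Qed.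

Lemma lambda_maxP (R : realType) (n : nat) (M : 'M[R[i]]_n) :
  (0 < n)%N -> M \is hermsymmx ->
  eigenvalue M (lambda_max M)%:C /\
  forall z : R[i], eigenvalue M z -> z <= (lambda_max M)%:C.
Proof.
move=> n_gt0 Mh.
have evR z : eigenvalue M z -> z = (complex.Re z)%:C.
  by move=> /(hermitian_eigenvalue_real Mh)/RRe_real ->.
have [s Ms] := closed_field_poly_normal (char_poly M).
have evE z : eigenvalue M z = (z \in s).
  rewrite eigenvalue_root_char Ms rootZ ?root_prod_XsubC//.
  by rewrite (monicP (char_poly_monic M)) oner_eq0.
have [a Ma] := eigenvalue_closed M n_gt0.
have [m Mm m_max] : exists2 m : R, eigenvalue M m%:C &
    forall x : R, eigenvalue M x%:C -> x <= m.
  have as_ : a \in s by rewrite -evE.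
  pose m := [arg max_(i > SeqSub as_) complex.Re (ssval i)]%O.
  exists (complex.Re (ssval m)); first by rewrite -evR evE ssvalP.
  move=> x; rewrite evE => xs; rewrite /m; case: arg_maxP => //= j _.
  by move=> /(_ (SeqSub xs) isT).
have -> : lambda_max M = m.
  apply/eqP; rewrite eq_le; apply/andP; split.
    by apply: ge_sup; [exists m|move=> x; exact: m_max].
  by apply: ub_le_sup => //; exists m => x; exact: m_max.
split=> // z zM; have ez := evR z zM.
have zm : complex.Re z <= m by apply: m_max; rewrite -ez.
rewrite ez; exact/(etrans (lecR _ _) zm).
Qed.

(* Main.v *)
Require Import Defs.
From HB Require Import structures.
From mathcomp Require Import all_boot all_order all_algebra all_fingroup.
From mathcomp Require Import complex reals.
From mathcomp Require Import sesquilinear.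

(** The hypothesis is tested on a first-order perturbation of the all-ones
    matrix [J], for which it is an equality.  Let [v] be a row vector, let [E]
    be the rank-one matrix with entries [v_i * conj v_j], and put
    [B = J + s E] with [s > 0], which is positive semidefinite.  Both sides of
    the hypothesis are then polynomials in [s] with constant coefficient
    [per A].  The coefficient of [s] is [\sum_i \sum_j E i j * F_mx A i j] in
    [per (A o B)], since the permutations sending [i] to [j] contribute
    [F_mx A i j] to [per A] ([sum_perm_fiberE], [coef1_permanent_pencil]), and
    it is [per A * |v|^2] in [per A * \prod_i B i i] ([coef1_prod]).  A
    polynomial without constant term that is nonnegative at all small positive
    [s] has a nonnegative coefficient of [s] ([horner_ge0_coef1]).  So the
    Hermitian form of [F_mx A] at [v] is at most [per A * |v|^2]
    ([F_mx_quadratic_le]), and taking for [v] an eigenvector of the Hermitian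
    matrix [F_mx A] for its largest eigenvalue gives the bound. *)

Import Order.TTheory GRing.Theory Num.Theory.
Local Open Scope ring_scope.

(** * Expansion of a permanent along one entry *)

Lemma lift_perm_onto (n : nat) (i j : 'I_n.+1) (s : 'S_n.+1) :
  s i = j -> exists t : 'S_n, lift_perm i j t = s.
Proof.
move=> sij.
pose f k := odflt k (unlift j (s (lift i k))).
have fK k : lift j (f k) = s (lift i k).
  rewrite /f; case: unliftP => [l -> //|].
  by rewrite -sij => /perm_inj/esym/eqP; rewrite (negPf (neq_lift _ _)).
have f_inj : injective f.
  by move=> k l /(congr1 (lift j)); rewrite !fK => /perm_inj/lift_inj.
exists (perm f_inj); apply/permP => k.
by case: (unliftP i k) => [l|] ->;
  rewrite ?lift_perm_lift ?lift_perm_id ?permE ?fK.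
Qed.

Lemma lift_perm_injr (n : nat) (i j : 'I_n.+1) :
  injective (lift_perm i j : 'S_n -> 'S_n.+1).
Proof.
move=> s t /permP st; apply/permP => k.
by have := st (lift i k); rewrite !lift_perm_lift => /lift_inj.
Qed.

(** The permanent analogue of the cofactor expansion: deleting row [i] and
    column [j] identifies the permutations sending [i] to [j] with all the
    permutations of one index fewer. *)
Lemma sum_perm_fiberE (C : comNzRingType) (n : nat) (A : 'M[C]_n) (i j : 'I_n) :
  \sum_(s : 'S_n | s i == j) \prod_(k < n) A k (s k) = F_mx A i j.
Proof.
case: n A i j => [|n] A i j; first by case: i.
pose g (s : 'S_n.+1) : 'S_n := odflt 1%g [pick t | lift_perm i j t == s].
rewrite (reindex (lift_perm i j)); last first.
  exists g => s.
    move=> _; rewrite /g; case: pickP => [t /eqP/lift_perm_injr -> //|].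
    by move=> /(_ s); rewrite eqxx.
  rewrite inE => /eqP/lift_perm_onto[t <-]; rewrite /g.
  by case: pickP => [u /eqP -> //|/(_ t)]; rewrite eqxx.
rewrite mxE /permanent big_distrr /=.
apply: eq_big => [s|s _]; first by rewrite lift_perm_id eqxx.
rewrite (bigD1_ord i) //= lift_perm_id; congr (_ * _).
by apply: eq_bigr => k _; rewrite lift_perm_lift !mxE.
Qed.

(** * Hermitian and positive semidefinite matrices *)

Lemma permanent_tr (C : comNzRingType) (n : nat) (A : 'M[C]_n) :
  permanent A^T = permanent A.
Proof.
rewrite /permanent (reindex_inj invg_inj) /=; apply: eq_bigr => s _.
rewrite (reindex_inj (@perm_inj _ s)) /=.
by apply: eq_bigr => k _; rewrite mxE permK.
Qed.

Lemma permanent_map (C D : comNzRingType) (f : {rmorphism C -> D}) (n : nat)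
    (A : 'M[C]_n) : permanent (map_mx f A) = f (permanent A).
Proof.
rewrite /permanent rmorph_sum; apply: eq_bigr => s _.
by rewrite rmorph_prod; apply: eq_bigr => k _; rewrite mxE.
Qed.

Lemma hermsymmxP (C : numClosedFieldType) (n : nat) (A : 'M[C]_n) :
  reflect (forall i j, A i j = (A j i)^*) (A \is hermsymmx).
Proof.
apply: (iffP (is_hermitianmxP _ _ _)); rewrite expr0 scale1r.
  by move=> {1}-> i j; rewrite !mxE.
by move=> AE; apply/matrixP => i j; rewrite !mxE.
Qed.

Lemma F_mx_hermsymmx (C : numClosedFieldType) (n : nat) (A : 'M[C]_n) :
  A \is hermsymmx -> F_mx A \is hermsymmx.
Proof.
move=> /hermsymmxP AE; apply/hermsymmxP => i j.
rewrite !mxE rmorphM /= -AE -permanent_map -permanent_tr.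
by congr (_ * permanent _); apply/matrixP => k l; rewrite !mxE; apply: AE.
Qed.

Lemma psd_hermitianD (C : numClosedFieldType) (n : nat) (A B : 'M[C]_n) :
  psd_hermitian A -> psd_hermitian B -> psd_hermitian (A + B).
Proof.
move=> [/hermsymmxP Ah A0] [/hermsymmxP Bh B0]; split=> [|v].
  by apply/hermsymmxP => i j; rewrite !mxE rmorphD /= -Ah -Bh.
by rewrite mulmxDr mulmxDl mxE addr_ge0.
Qed.

Lemma psd_hermitianZ (C : numClosedFieldType) (n : nat) (s : C) (A : 'M[C]_n) :
  0 <= s -> psd_hermitian A -> psd_hermitian (s *: A).
Proof.
move=> s0 [/hermsymmxP Ah A0]; split=> [|v].
  apply/hermsymmxP => i j.
  by rewrite !mxE rmorphM /= -Ah (CrealP (ger0_real s0)).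
by rewrite -scalemxAr -scalemxAl mxE mulr_ge0.
Qed.

(** The form [w^* M w] of this matrix [M] is the squared modulus of a linear
    form in [w]. *)
Lemma psd_hermitian_rank1 (C : numClosedFieldType) (n : nat) (v : 'rV[C]_n) :
  psd_hermitian (\matrix_(i, j) (v 0 i * (v 0 j)^*)).
Proof.
split=> [|w].
  by apply/hermsymmxP => i j; rewrite !mxE rmorphM /= conjCK mulrC.
suff -> : (w ^t* *m (\matrix_(i, j) (v 0 i * (v 0 j)^*)) *m w)%sesqui 0 0 =
    (\sum_i (w i 0)^* * v 0 i) * (\sum_i (w i 0)^* * v 0 i)^*.
  exact: mul_conjC_ge0.
rewrite rmorph_sum mulr_sumr mxE; apply: eq_bigr => j _.
rewrite mxE !mulr_suml; apply: eq_bigr => i _.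
by rewrite !mxE rmorphM /= conjCK !mulrA -!mulrA [w j 0 * _]mulrC.
Qed.

(** * The polynomial [per (A o (J + X E))] *)

Lemma coef0_prod_eq1 (C : comNzRingType) (I : Type) (r : seq I)
    (p : I -> {poly C}) : (forall i, (p i)`_0 = 1) -> (\prod_(i <- r) p i)`_0 = 1.
Proof. by move=> p0; rewrite coef0_prod big1. Qed.

(** To first order, a product of factors [1 + c_i X + ...] is
    [1 + (\sum_i c_i) X]. *)
Lemma coef1_prod (C : comNzRingType) (I : Type) (r : seq I)
    (p : I -> {poly C}) : (forall i, (p i)`_0 = 1) ->
  (\prod_(i <- r) p i)`_1 = \sum_(i <- r) (p i)`_1.
Proof.
move=> p0; elim: r => [|i r IHr]; first by rewrite !big_nil coef1.
rewrite !big_cons coefM big_ord_recl big_ord1 /= IHr p0 mul1r.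
by rewrite coef0_prod_eq1 // mulr1 addrC.
Qed.

(** The permanent of [A o (J + X E)], with [J] the all-ones matrix and [X] the
    polynomial variable. *)
Definition permanent_pencil {C : comNzRingType} {n : nat} (A E : 'M[C]_n) :
    {poly C} :=
  permanent (\matrix_(i, j) ((A i j)%:P * (1 + E i j *: 'X))).

Lemma horner_permanent_pencil {C : comNzRingType} {n : nat} (A E : 'M[C]_n)
    (s : C) :
  (permanent_pencil A E).[s] =
  permanent (hadamard A (const_mx 1 + s *: E)).
Proof.
rewrite /permanent_pencil -[LHS]/(horner_eval s _) -permanent_map.
congr permanent; apply/matrixP => i j; rewrite !mxE /= /horner_eval.
by rewrite !hornerE [s * _]mulrC.
Qed.

Lemma coef0_pencil_factor (C : comNzRingType) (c : C) :
  (1 + c *: 'X)`_0 = 1 :> C.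
Proof. by rewrite !coefE mulr0 addr0. Qed.

Lemma coef1_pencil_factor (C : comNzRingType) (c : C) :
  (1 + c *: 'X)`_1 = c :> C.
Proof. by rewrite !coefE mulr1 add0r. Qed.

Lemma permanent_pencilE (C : comNzRingType) (n : nat) (A E : 'M[C]_n) :
  permanent_pencil A E = \sum_(s : 'S_n)
    (\prod_i A i (s i)) *: \prod_i (1 + E i (s i) *: 'X).
Proof.
apply: eq_bigr => s _; rewrite -mul_polyC rmorph_prod -big_split /=.
by apply: eq_bigr => i _; rewrite mxE.
Qed.

Lemma coef0_permanent_pencil {C : comNzRingType} {n : nat} (A E : 'M[C]_n) :
  (permanent_pencil A E)`_0 = permanent A.
Proof.
rewrite permanent_pencilE coef_sum; apply: eq_bigr => s _.
rewrite coefZ coef0_prod_eq1 ?mulr1 // => i; exact: coef0_pencil_factor.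
Qed.

(** Each permutation [s] contributes [E i (s i)] for every [i], weighted by its
    term in [per A]; grouping the permutations by the value [s i = j] turns the
    weights into the entries of [F_mx A]. *)
Lemma coef1_permanent_pencil {C : comNzRingType} {n : nat} (A E : 'M[C]_n) :
  (permanent_pencil A E)`_1 = \sum_i \sum_j E i j * F_mx A i j.
Proof.
rewrite permanent_pencilE coef_sum.
transitivity (\sum_(s : 'S_n) \sum_i E i (s i) * \prod_k A k (s k)).
  apply: eq_bigr => s _; rewrite coefZ coef1_prod => [|i].
    rewrite mulr_sumr; apply: eq_bigr => i _.
    by rewrite coef1_pencil_factor mulrC.
  exact: coef0_pencil_factor.
rewrite exchange_big /=; apply: eq_bigr => i _.
rewrite (partition_big (fun s : 'S_n => s i) predT) //=.
apply: eq_bigr => j _; rewrite -sum_perm_fiberE mulr_sumr.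
by apply: eq_bigr => s /eqP ->.
Qed.

(** * First-order test at zero *)

(** The cone of nonnegative elements is closed, also for the partial order of a
    complex field.  Being nonnegative means being equal to one's norm, so the
    distance from [z = p`_0] to [`|z|] measures the failure; it is at most twice
    the distance from [z] to the nonnegative number [p.[s]], which is [O(s)]. *)
Lemma horner_ge0_coef0 (C : numFieldType) (p : {poly C}) :
  (forall s, 0 < s -> s <= 1 -> 0 <= p.[s]) -> 0 <= p`_0.
Proof.
move=> p_ge0; set z := p`_0.
have [q pE] : exists q, p = z%:P + 'X * q.
  exists (Poly (behead p)); apply/polyP => k.
  rewrite coefD coefXM coefC coef_Poly nth_behead.
  by case: k => [|k] /=; rewrite ?addr0 ?add0r.
have [M qM] := poly_disk_bound q 1.
have M0 : 0 <= M by apply: le_trans (qM 0 _); rewrite ?normr0.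
pose d := `|z - `|z| |.
suff /eqP : d = 0.
  by rewrite normr_eq0 subr_eq0 => /eqP ->.
apply/eqP; apply: contraT => dn0.
have d_gt0 : 0 < d by rewrite lt_neqAle eq_sym dn0 normr_ge0.
have D_gt0 : 0 < M *+ 2 + d by rewrite ltr_wpDl // mulrn_wge0.
(* Chosen so that [2 M s < d], against the bound [d <= 2 M s] below. *)
pose s := d / (M *+ 2 + d).
have s_gt0 : 0 < s by rewrite divr_gt0.
have s_le1 : s <= 1 by rewrite ler_pdivrMr // mul1r lerDr mulrn_wge0.
have u0 := p_ge0 s s_gt0 s_le1.
have zu : `|z - p.[s]| <= s * M.
  rewrite pE !hornerE opprD addNKr normrN normrM (gtr0_norm s_gt0).
  by rewrite ler_pM2l // qM // gtr0_norm.
have dle : d <= (s * M) *+ 2.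
  apply: le_trans (ler_distD p.[s] _ _) _; rewrite mulr2n lerD //.
  rewrite -{1}(ger0_norm u0); apply: le_trans (ler_dist_dist _ _) _.
  by rewrite distrC.
have : d * (M *+ 2 + d) <= d * (M *+ 2).
  by rewrite -ler_pdivlMr // mulrAC mulrnAr.
by rewrite ler_pM2l // gerDl lt_geF.
Qed.

Lemma horner_ge0_coef1 (C : numFieldType) (p : {poly C}) :
  p`_0 = 0 -> (forall s, 0 < s -> s <= 1 -> 0 <= p.[s]) -> 0 <= p`_1.
Proof.
move=> p0 p_ge0.
have pE : p = 'X * Poly (behead p).
  apply/polyP => k; rewrite coefXM coef_Poly nth_behead.
  by case: k.
rewrite pE coefXM /=; apply: horner_ge0_coef0 => s s_gt0 s_le1.
by rewrite -(pmulr_rge0 _ s_gt0) -{1}(hornerX s) -hornerM -pE p_ge0.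
Qed.

(** * The eigenvalue bound *)

(** The hypothesis at [J + s E], with [E] the rank-one matrix of [v], compared at
    first order in [s].  The conjugate stands on the index [j] because [v] is a
    row vector: the left-hand side is [v F v^*]. *)
Lemma F_mx_quadratic_le (C : numClosedFieldType) (n : nat) (A : 'M[C]_n) :
  (forall B : 'M[C]_n, psd_hermitian B ->
     permanent (hadamard A B) <= permanent A * \prod_(i < n) B i i) ->
  forall v : 'rV[C]_n,
  \sum_i \sum_j v 0 i * (v 0 j)^* * F_mx A i j <=
    permanent A * \sum_i v 0 i * (v 0 i)^*.
Proof.
move=> A_max v.
pose E : 'M[C]_n := \matrix_(i, j) (v 0 i * (v 0 j)^*).
have -> : \sum_i \sum_j v 0 i * (v 0 j)^* * F_mx A i j =
    (permanent_pencil A E)`_1.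
  rewrite coef1_permanent_pencil; apply: eq_bigr => i _.
  by apply: eq_bigr => j _; rewrite [E i j]mxE.
have -> : permanent A * \sum_i v 0 i * (v 0 i)^* =
    (permanent A *: \prod_i (1 + E i i *: 'X))`_1.
  rewrite coefZ coef1_prod => [|i]; last exact: coef0_pencil_factor.
  by congr (_ * _); apply: eq_bigr => i _; rewrite coef1_pencil_factor mxE.
rewrite -subr_ge0 -coefB; apply: horner_ge0_coef1 => [|s s_gt0 _].
  rewrite coefB coefZ coef0_permanent_pencil coef0_prod_eq1 ?mulr1 ?subrr //.
  by move=> i; exact: coef0_pencil_factor.
have JE_psd : psd_hermitian (const_mx 1 + s *: E).
  apply: psd_hermitianD; last first.
    exact/psd_hermitianZ/psd_hermitian_rank1/ltW.
  have := psd_hermitian_rank1 _ _ (const_mx 1 : 'rV[C]_n); congr psd_hermitian.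
  by apply/matrixP => i j; rewrite !mxE rmorph1 mulr1.
rewrite hornerD hornerN hornerZ horner_permanent_pencil horner_prod subr_ge0.
apply: le_trans (A_max _ JE_psd) _.
rewrite le_eqVlt; apply/orP; left; apply/eqP; congr (_ * _).
apply: eq_bigr => i _; rewrite !hornerE [LHS]mxE; congr (_ + _); rewrite mxE //.
by rewrite mulrC.
Qed.

Local Open Scope complex_scope.

Theorem theorem1 (R : realType) (n : nat) (n_ge1 : (1 <= n)%N)
    (A : 'M[R[i]]_n) (A_psd : psd_hermitian A)
    (A_max : forall B : 'M[R[i]]_n, psd_hermitian B ->
       permanent (hadamard A B) <= permanent A * \prod_(i < n) B i i) :
  (lambda_max (F_mx A))%:C <= permanent A.
Proof.
have Fh : F_mx A \is hermsymmx by apply: F_mx_hermsymmx; case: A_psd.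
have [/eigenvalueP[v vF v_neq0] _] := lambda_maxP n_ge1 Fh.
have norm_v_gt0 : 0 < \sum_i v 0 i * ((v 0 i)^*)%R.
  have [k vk0] := rV0Pn _ v_neq0.
  rewrite (bigD1 k) //= ltr_pwDl ?mul_conjC_gt0 //.
  by apply: sumr_ge0 => i _; apply: mul_conjC_ge0.
have := F_mx_quadratic_le _ _ _ A_max v.
suff -> : \sum_i \sum_j v 0 i * ((v 0 j)^*)%R * F_mx A i j =
    (lambda_max (F_mx A))%:C * \sum_i v 0 i * ((v 0 i)^*)%R by rewrite ler_pM2r.
rewrite exchange_big mulr_sumr; apply: eq_bigr => j _ /=.
have /rowP/(_ j) := vF; rewrite [X in _ = X -> _]mxE mulrA => <-.
by rewrite mxE mulr_suml; apply: eq_bigr => i _; rewrite mulrAC.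
Qed.
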